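(* Let $\triangle$ be a simplicial complex on a finite vertex set $V$ and let $M=M_\triangle$ be its simplicial binoid. Then there exists an isomorphism of sheaves of abelian groups on $\operatorname{Spec}M$ $$\bigoplus_{v\in V}\mathcal O^*_v\longrightarrow\mathcal O^*_M,$$ where $\mathcal O^*_M$ is the sheaf of units of the structure sheaf of $\operatorname{Spec} M$ and $\mathcal O^*_v$ is the extension by zero of the constant sheaf $\mathbb Z$ on $D(x_v)$.
   Context: A binoid $(M,+,0,\infty)$ is a commutative monoid with an absorbing element $\infty$; $M^*$ is its group of units. An ideal is a subset $I\ni\infty$ with $M+I\subseteq I$; it is prime if $I\ne M$ and $a+b\in I$ implies $a\in I$ or $b\in I$. $\operatorname{Spec}M$ is the set of prime ideals with the topology having basis $D(f)=\{\mathfrak p\mid f\notin\mathfrak p\}$, $f\in M$. The structure sheaf $\mathcal O_M$ is the sheaf of binoids associated to $D(f)\mapsto M_f$ (localization of $M$ at $f$), and $\mathcal O_M^*(U)=(\mathcal O_M(U))^*$. A simplicial complex $\triangle$ on $V$ is a set of subsets of $V$ closed under taking subsets and containing all singletons. $M_\triangle$ is the commutative binoid generated by $x_v$, $v\in V$, with relations $\sum_{v\in H}x_v=\infty$ for all $H\subseteq V$, $H\notin\triangle$. For $v\in V$, $\mathcal O^*_v$ is the sheafification of the presheaf $U\mapsto\mathbb Z$ if $U\subseteq D(x_v)$, and $U\mapsto 0$ otherwise, i.e. the extension by zero of the constant sheaf $\mathbb Z$ along the open embedding $D(x_v)\hookrightarrow\operatorname{Spec}M$. *)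

(* Defs.v *)
From HB Require Import structures.
From mathcomp Require Import all_boot all_order all_algebra.
From mathcomp Require Import all_classical topology.

Set Implicit Arguments.
Unset Strict Implicit.
Unset Printing Implicit Defensive.

Import GRing.Theory.
Local Open Scope ring_scope.
Local Open Scope classical_set_scope.
Local Open Scope quotient_scope.

HB.mixin Record Nmodule_isBinoid M of GRing.Nmodule M := {
  binf : M;
  addinfr : forall x : M, binf + x = binf
}.

#[short(type="binoidType")]
HB.structure Definition Binoid := {M of GRing.Nmodule M & Nmodule_isBinoid M}.

Arguments binf {s}.

Lemma addrinf (M : binoidType) (x : M) : x + binf = binf.
Proof. by rewrite addrC addinfr. Qed.

Section Units.
Variable M : nmodType.

Definition is_unit : {pred M} := fun x => `[< exists y, x + y = 0 >].

Lemma is_unitP x : reflect (exists y, x + y = 0) (x \in is_unit).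
Proof. exact: asboolP. Qed.

Record units := Units { uval :> M; uvalP : uval \in is_unit }.

HB.instance Definition _ := [isSub for uval].
HB.instance Definition _ := [Choice of units by <:].

Fact units0_subproof : 0 \in is_unit.
Proof. by apply/is_unitP; exists 0; rewrite addr0. Qed.

Fact unitsD_subproof (u v : units) : uval u + uval v \in is_unit.
Proof.
have /is_unitP[x ux] := uvalP u; have /is_unitP[y vy] := uvalP v.
by apply/is_unitP; exists (x + y); rewrite addrACA ux vy addr0.
Qed.

Definition units_add (u v : units) : units := Units (unitsD_subproof u v).

Fact units_addA : associative units_add.
Proof. by move=> u v w; apply/val_inj; rewrite /= addrA. Qed.
Fact units_addC : commutative units_add.
Proof. by move=> u v; apply/val_inj; rewrite /= addrC. Qed.
Fact units_add0 : left_id (Units units0_subproof) units_add.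
Proof. by move=> u; apply/val_inj; rewrite /= add0r. Qed.

HB.instance Definition _ :=
  GRing.isNmodule.Build units units_addA units_addC units_add0.

Definition uinv (u : units) : M := sval (cid (is_unitP _ (uvalP u))).

Lemma uinvP u : uval u + uinv u = 0.
Proof. by rewrite /uinv; case: cid. Qed.

Fact uinv_unit u : uinv u \in is_unit.
Proof. by apply/is_unitP; exists (uval u); rewrite addrC uinvP. Qed.

Definition uopp (u : units) : units := Units (uinv_unit u).

Fact uaddN : left_inverse 0 uopp +%R.
Proof. by move=> u; apply/val_inj; rewrite /= addrC uinvP. Qed.

HB.instance Definition _ := GRing.Nmodule_isZmodule.Build units uaddN.

End Units.

Section UnitsMap.
Variables (M N : nmodType) (f : {additive M -> N}).

Fact units_map_subproof (u : units M) : f (uval u) \in @is_unit N.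
Proof.
have /is_unitP[y uy] := uvalP u.
by apply/is_unitP; exists (f y); rewrite -raddfD uy raddf0.
Qed.

Definition units_map (u : units M) : units N := Units (units_map_subproof u).

Fact units_map_is_additive : nmod_morphism units_map.
Proof.
split; first by apply/val_inj; rewrite /= raddf0.
by move=> u v; apply/val_inj; rewrite /= raddfD.
Qed.

HB.instance Definition _ :=
  GRing.isNmodMorphism.Build (units M) (units N) units_map units_map_is_additive.
End UnitsMap.

Section Congruence.
Variable M : binoidType.

Definition congruence (E : M -> M -> Prop) :=
  [/\ forall a, E a a,
      forall a b, E a b -> E b a,
      forall a b c, E a b -> E b c -> E a c
    & forall a b c, E a b -> E (c + a) (c + b)].

Variable R : M -> M -> Prop.

Definition gen_cong : rel M := fun a b =>
  `[< forall E, congruence E -> (forall x y, R x y -> E x y) -> E a b >].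

Lemma gen_congP : congruence gen_cong.
Proof.
split.
- by move=> a; apply/asboolP => E [].
- move=> a b /asboolP ab; apply/asboolP => E cE RE.
  by case: (cE) => _ + _ _; apply; apply: ab.
- move=> a b c /asboolP ab /asboolP bc; apply/asboolP => E cE RE.
  by case: (cE) => _ _ + _; apply; [apply: ab|apply: bc].
- move=> a b c /asboolP ab; apply/asboolP => E cE RE.
  by case: (cE) => _ _ _; apply; apply: ab.
Qed.

Fact gen_cong_refl : reflexive gen_cong.
Proof. by case: gen_congP. Qed.
Fact gen_cong_sym : symmetric gen_cong.
Proof. by case: gen_congP => _ s _ _ a b; apply/idP/idP; apply: s. Qed.
Fact gen_cong_trans : transitive gen_cong.
Proof. by case: gen_congP => _ _ t _ b a c; apply: t. Qed.

Canonical gen_cong_equiv :=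
  EquivRel gen_cong gen_cong_refl gen_cong_sym gen_cong_trans.

Definition bquot := {eq_quot gen_cong}.
HB.instance Definition _ := Choice.on bquot.
HB.instance Definition _ := EqQuotient.on bquot.

Lemma bquotP (a b : M) : \pi_bquot a = \pi_bquot b <-> gen_cong a b.
Proof. by split=> [/eqmodP//|h]; apply/eqmodP. Qed.

Lemma bquotW (Q : bquot -> Prop) : (forall a, Q (\pi_bquot a)) -> forall s, Q s.
Proof. by move=> h s; rewrite -[s]reprK; apply: h. Qed.

Definition bquot_add (a b : bquot) : bquot := \pi_bquot (repr a + repr b).

Lemma bquot_addE (a b : M) : bquot_add (\pi_bquot a) (\pi_bquot b) = \pi_bquot (a + b).
Proof.
apply/bquotP; case: gen_congP => _ _ t c.
have ra : gen_cong (repr (\pi_bquot a)) a by apply/bquotP; rewrite reprK.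
have rb : gen_cong (repr (\pi_bquot b)) b by apply/bquotP; rewrite reprK.
apply: (t _ (repr (\pi_bquot a) + b)); first exact: c.
by rewrite ![_ + b]addrC; apply: c.
Qed.

Fact bquot_addA : associative bquot_add.
Proof.
elim/bquotW=> a; elim/bquotW=> b; elim/bquotW=> c.
by rewrite !bquot_addE addrA.
Qed.
Fact bquot_addC : commutative bquot_add.
Proof. by elim/bquotW=> a; elim/bquotW=> b; rewrite !bquot_addE addrC. Qed.
Fact bquot_add0 : left_id (\pi_bquot 0) bquot_add.
Proof. by elim/bquotW=> a; rewrite bquot_addE add0r. Qed.

HB.instance Definition _ :=
  GRing.isNmodule.Build bquot bquot_addA bquot_addC bquot_add0.

Fact bquot_addinf (a : bquot) : \pi_bquot binf + a = \pi_bquot binf.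
Proof. by elim/bquotW: a => a; rewrite [LHS]bquot_addE addinfr. Qed.

HB.instance Definition _ := Nmodule_isBinoid.Build bquot bquot_addinf.

End Congruence.

Record simplicial_complex (V : finType) := SimplicialComplex {
  faces :> {set {set V}};
  faces_sub : forall A B : {set V}, A \in faces -> B \subset A -> B \in faces;
  faces_vertex : forall v : V, [set v]%SET \in faces
}.

(* The free commutative binoid on V, i.e. N^V with an absorbing element
   [None] adjoined. *)
Definition free_binoid (V : finType) := option {ffun V -> nat}.

Section FreeBinoid.
Variable V : finType.
Local Notation F := (free_binoid V).

HB.instance Definition _ := Choice.on F.

Definition free_add (a b : F) : F :=
  if a is Some a' then if b is Some b' then Some (a' + b') else None else None.

Fact free_addA : associative free_add.
Proof. by move=> [a|] [b|] [c|] //=; rewrite addrA. Qed.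
Fact free_addC : commutative free_add.
Proof. by move=> [a|] [b|] //=; rewrite addrC. Qed.
Fact free_add0 : left_id (Some 0) free_add.
Proof. by move=> [a|] //=; rewrite add0r. Qed.

HB.instance Definition _ := GRing.isNmodule.Build F free_addA free_addC free_add0.

Fact free_addinf (a : F) : (None : F) + a = None. Proof. by []. Qed.

HB.instance Definition _ := Nmodule_isBinoid.Build F free_addinf.

Definition free_gen (v : V) : F := Some [ffun w => (w == v : nat)].

End FreeBinoid.

Section SimplicialBinoid.
Variables (V : finType) (K : simplicial_complex V).

Definition simplicial_rel (a b : free_binoid V) : Prop :=
  exists2 H : {set V}, H \notin faces K &
    a = \sum_(v in H) free_gen v /\ b = binf.

Definition simplicial_binoid := bquot simplicial_rel.

HB.instance Definition _ := Binoid.on simplicial_binoid.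

Definition sgen (v : V) : simplicial_binoid := \pi_simplicial_binoid (free_gen v).

End SimplicialBinoid.

Section Spectrum.
Variable M : binoidType.

Definition ideal (I : set M) := I binf /\ forall a b, I b -> I (a + b).

Definition prime_ideal (I : set M) :=
  [/\ ideal I, I <> setT & forall a b, I (a + b) -> I a \/ I b].

Record spec := Spec { pideal :> set M; pidealP : prime_ideal pideal }.

HB.instance Definition _ := gen_eqMixin spec.
HB.instance Definition _ := gen_choiceMixin spec.

Definition specD (f : M) : set spec := [set p | ~ pideal p f].

Lemma specD0 : specD 0 = setT.
Proof.
apply/seteqP; split=> // p _ /= p0.
have [[_ pI] pT _] := pidealP p; apply: pT.
by apply/seteqP; split=> // a _; rewrite -[a]addr0; apply: pI.
Qed.

Lemma specDI f g : specD (f + g) = specD f `&` specD g.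
Proof.
apply/seteqP; split=> p /=; have [[_ pI] _ pP] := pidealP p.
- by move=> pfg; split=> h; apply: pfg; [rewrite addrC|]; apply: pI.
- by move=> [pf pg] /pP[].
Qed.

Fact spec_cover : \bigcup_(A in range specD) A = setT.
Proof.
apply/seteqP; split=> // p _; exists setT => //.
by exists 0 => //; apply: specD0.
Qed.

Fact spec_join (A B : set spec) p : range specD A -> range specD B ->
  A p -> B p -> exists C, [/\ range specD C, C p & C `<=` A `&` B].
Proof.
move=> [f _ <-] [g _ <-] pf pg; exists (specD (f + g)); split.
- by exists (f + g).
- by rewrite specDI.
- by rewrite specDI.
Qed.

HB.instance Definition _ := isBaseTopological.Build spec spec_cover spec_join.

Lemma spec_openE (U : set spec) :
  open U <-> forall p, U p -> exists2 f, specD f p & specD f `<=` U.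
Proof.
split.
- move=> [D' D'D <-] p [A D'A Ap]; have [f _ fA] := D'D _ D'A.
  by exists f; rewrite fA // => q Aq; exists A.
- move=> h; exists [set A | range specD A /\ A `<=` U]; first by move=> A [].
  apply/seteqP; split=> [p [A [_ AU] /AU//]|p Up].
  by have [f fp fU] := h p Up; exists (specD f) => //; split=> //; exists f.
Qed.

Lemma specD_open f : open (specD f).
Proof. by apply/spec_openE => p fp; exists f. Qed.

(* The complement of the set of m dividing some n f is a prime ideal, unless
   [binf] belongs to that set. *)
Lemma specD_sub f g : specD f `<=` specD g ->
  exists nc : nat * M, f *+ nc.1 = g + nc.2.
Proof.
move=> fg; pose S := [set m : M | exists nc : nat * M, f *+ nc.1 = m + nc.2].
have [[[n c] /= e]|Sinf] := pselect (S binf).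
  by exists (n, binf); rewrite /= e addinfr addrinf.
have P : prime_ideal (~` S).
  split; first (split=> //= a b Sb [[n c] /= e]; apply: Sb).
  - by exists (n, a + c); rewrite /= e addrCA addrA.
  - move=> /seteqP[_ /(_ 0 I)]; apply.
    by exists (0%N, 0); rewrite /= addr0.
  - move=> a b Sab; apply/not_andP => -[[[n c] /= e] [[m d] /= e']]; apply: Sab.
    by exists ((n + m)%N, c + d); rewrite /= mulrnDr e e' addrACA.
have /fg/contrapT // : specD f (Spec P).
by apply; exists (1%N, 0); rewrite /= addr0.
Qed.

End Spectrum.

Section Localization.
Variables (M : binoidType) (f : M).

(* The pair (a, m) stands for the fraction a - m f. *)
Definition loc_rel : rel (M * nat) := fun s t =>
  `[< exists k, s.1 + f *+ (t.2 + k) = t.1 + f *+ (s.2 + k) >].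

Fact loc_rel_refl : reflexive loc_rel.
Proof. by move=> s; apply/asboolP; exists 0%N. Qed.
Fact loc_rel_sym : symmetric loc_rel.
Proof. by move=> s t; apply/asboolP/asboolP => -[k e]; exists k. Qed.
Fact loc_rel_trans : transitive loc_rel.
Proof.
move=> [b n] [a m] [c p] /asboolP[k /= e] /asboolP[l /= e'].
apply/asboolP; exists (k + (n + l))%N => /=.
have -> : (p + (k + (n + l)) = (n + k) + (p + l))%N.
  by rewrite [LHS](AC (1*(1*2)) (3*2*(1*4))).
have -> : (m + (k + (n + l)) = (n + l) + (m + k))%N.
  by rewrite [LHS](AC (1*(1*2)) (3*4*(1*2))).
by rewrite mulrnDr addrA e addrAC e' -addrA -mulrnDr.
Qed.

Canonical loc_equiv := EquivRel loc_rel loc_rel_refl loc_rel_sym loc_rel_trans.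

Definition loc := {eq_quot loc_rel}.
HB.instance Definition _ := Choice.on loc.
HB.instance Definition _ := EqQuotient.on loc.

Definition frac (a : M) (m : nat) : loc := \pi_loc (a, m).

Lemma fracP a m b n :
  frac a m = frac b n <-> exists k, a + f *+ (n + k) = b + f *+ (m + k).
Proof.
by split=> [/eqmodP/asboolP//|h]; apply/eqmodP/asboolP.
Qed.

Lemma fracW (Q : loc -> Prop) : (forall a m, Q (frac a m)) -> forall s, Q s.
Proof. by move=> h s; rewrite -[s]reprK; case: (repr s) => a m; apply: h. Qed.

Definition loc_add (s t : loc) : loc :=
  frac ((repr s).1 + (repr t).1) ((repr s).2 + (repr t).2).

Lemma loc_addE a m b n : loc_add (frac a m) (frac b n) = frac (a + b) (m + n).
Proof.
have /fracP[k e] :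
    frac (repr (frac a m)).1 (repr (frac a m)).2 = frac a m.
  by rewrite /frac -surjective_pairing reprK.
have /fracP[l e'] :
    frac (repr (frac b n)).1 (repr (frac b n)).2 = frac b n.
  by rewrite /frac -surjective_pairing reprK.
apply/fracP; exists (k + l)%N.
by rewrite !(addnACA _ _ k l) !mulrnDr addrACA -!mulrnDr e e' !mulrnDr addrACA.
Qed.

Fact loc_addA : associative loc_add.
Proof.
elim/fracW=> a m; elim/fracW=> b n; elim/fracW=> c p.
by rewrite !loc_addE addrA addnA.
Qed.
Fact loc_addC : commutative loc_add.
Proof.
by elim/fracW=> a m; elim/fracW=> b n; rewrite !loc_addE addrC addnC.
Qed.
Fact loc_add0 : left_id (frac 0 0) loc_add.
Proof. by elim/fracW=> a m; rewrite loc_addE add0r. Qed.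

HB.instance Definition _ := GRing.isNmodule.Build loc loc_addA loc_addC loc_add0.

Fact loc_addinf (s : loc) : frac binf 0 + s = frac binf 0.
Proof.
elim/fracW: s => a m; rewrite [LHS]loc_addE addinfr.
by apply/fracP; exists 0%N; rewrite !addinfr.
Qed.

HB.instance Definition _ := Nmodule_isBinoid.Build loc loc_addinf.

End Localization.

Section LocalizationMap.
Variables (M : binoidType) (f g : M) (fg : specD f `<=` specD g).

(* If n f = g + c, then a - m g is sent to (a + m c) - (n m) f; by [loc_resE]
   this depends on no choice. *)
Definition loc_res (s : loc g) : loc f :=
  let nc := sval (cid (specD_sub fg)) in
  frac f ((repr s).1 + nc.2 *+ (repr s).2) (nc.1 * (repr s).2).

Lemma loc_resE n c a m :
  f *+ n = g + c -> loc_res (frac g a m) = frac f (a + c *+ m) (n * m).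
Proof.
rewrite /loc_res; case: cid => -[n' c'] /= e' e.
have : frac g (repr (frac g a m)).1 (repr (frac g a m)).2 = frac g a m.
  by rewrite /frac -surjective_pairing reprK.
case: (repr _) => b p /= /fracP[k h]; apply/fracP; exists (n' * k)%N.
rewrite !mulrnDr !mulrnA e e' !mulrnDl.
have := congr1 (fun z => z + (c *+ m + c' *+ p + c' *+ k)) h.
rewrite !mulrnDr => h'.
by rewrite [LHS](AC (1*2*3) (1*5*(2*4*(3*6)))) [RHS](AC (1*2*3) (1*4*(2*5*(3*6)))) in h'.
Qed.

Fact loc_res_is_additive : nmod_morphism loc_res.
Proof.
have [[n c] /= e] := specD_sub fg; split.
  by rewrite [LHS](loc_resE _ _ e) muln0 mulr0n addr0.
elim/fracW=> a m; elim/fracW=> b p.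
rewrite [_ + _]loc_addE !(loc_resE _ _ e) [RHS]loc_addE.
by rewrite mulnDr mulrnDr addrACA.
Qed.

HB.instance Definition _ :=
  GRing.isNmodMorphism.Build (loc g) (loc f) loc_res loc_res_is_additive.

Lemma loc_res_inf : loc_res binf = binf.
Proof.
have [[n c] /= e] := specD_sub fg.
by rewrite [LHS](loc_resE _ _ e) addinfr muln0.
Qed.

End LocalizationMap.

Lemma loc_res_id (M : binoidType) (f : M) (ff : specD f `<=` specD f) s :
  loc_res ff s = s.
Proof.
elim/fracW: s => a m; rewrite (loc_resE _ (n := 1%N) (c := 0)) ?addr0 //.
by rewrite mul0rn addr0 mul1n.
Qed.

Lemma loc_res_comp (M : binoidType) (f g h : M) (fg : specD f `<=` specD g)
    (gh : specD g `<=` specD h) (fh : specD f `<=` specD h) s :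
  loc_res fg (loc_res gh s) = loc_res fh s.
Proof.
elim/fracW: s => a m.
have [[n c] /= e] := specD_sub fg; have [[p d] /= e'] := specD_sub gh.
rewrite (loc_resE _ _ _ e') (loc_resE _ _ _ e).
rewrite (loc_resE _ (n := (n * p)%N) (c := d + c *+ p)).
  by rewrite mulnA mulrnDl -mulrnA addrA.
by rewrite mulrnA e mulrnDl e' addrA.
Qed.

Record base (X : topologicalType) := Base {
  bidx : Type;
  bset :> bidx -> set X;
  bset_basis : basis (range bset)
}.

Section Base.
Variables (X : topologicalType) (B : base X).

Lemma base_open (i : bidx B) : open (B i).
Proof. by have [/(_ (B i)) h _] := bset_basis B; apply: h; exists i. Qed.

Lemma base_nbhs (U : set X) (x : X) : open U -> U x ->
  exists2 i, B i x & B i `<=` U.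
Proof.
move=> oU Ux; have [_ /(_ x U)] := bset_basis B.
case; first by apply: open_nbhs_nbhs.
by move=> _ /= [[i _ <-] ix] iU; exists i.
Qed.

Lemma base_nbhsI (i j : bidx B) (x : X) : B i x -> B j x ->
  exists k, [/\ B k x, B k `<=` B i & B k `<=` B j].
Proof.
move=> ix jx.
have [k kx kij] := base_nbhs (openI (base_open i) (base_open j)) (conj ix jx).
by exists k; split=> // y /kij[].
Qed.

End Base.

Record opens (X : topologicalType) := Opens {
  oset :> set X;
  oset_open : open oset
}.

Lemma opens_basis (X : topologicalType) : basis (range (@oset X)).
Proof.
split; first by move=> _ [U _ <-]; apply: oset_open.
move=> x A; rewrite nbhsE => -[U [oU Ux] UA].
by exists U => //; split=> //; exists (Opens oU).
Qed.

Definition opens_base (X : topologicalType) : base X := Base (opens_basis X).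

Definition opensI (X : topologicalType) (U V : opens X) : opens X :=
  Opens (openI (oset_open U) (oset_open V)).

Lemma opensIl (X : topologicalType) (U V : opens X) : opensI U V `<=` U.
Proof. by move=> x []. Qed.
Lemma opensIr (X : topologicalType) (U V : opens X) : opensI U V `<=` V.
Proof. by move=> x []. Qed.

Lemma spec_basis (M : binoidType) : basis (range (@specD M)).
Proof.
split; first by move=> _ [f _ <-]; apply: specD_open.
move=> p A; rewrite nbhsE => -[U [/spec_openE oU Up] UA].
have [f fp fU] := oU p Up.
by exists (specD f); [split=> //; exists f|apply: subset_trans UA].
Qed.

Definition spec_base (M : binoidType) : base (spec M) := Base (@spec_basis M).

Section Presheaves.
Variables (X : topologicalType) (B : base X).

Record nmodPresheaf := NmodPresheaf {
  npsec :> bidx B -> nmodType;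
  npres : forall i j, B i `<=` B j -> {additive npsec j -> npsec i};
  npres_id : forall i (ii : B i `<=` B i) s, npres ii s = s;
  npres_comp : forall i j k (ij : B i `<=` B j) (jk : B j `<=` B k)
    (ik : B i `<=` B k) s, npres ij (npres jk s) = npres ik s
}.

Record binoidPresheaf := BinoidPresheaf {
  bpsec :> bidx B -> binoidType;
  bpres : forall i j, B i `<=` B j -> {additive bpsec j -> bpsec i};
  bpres_inf : forall i j (ij : B i `<=` B j), bpres ij binf = binf;
  bpres_id : forall i (ii : B i `<=` B i) s, bpres ii s = s;
  bpres_comp : forall i j k (ij : B i `<=` B j) (jk : B j `<=` B k)
    (ik : B i `<=` B k) s, bpres ij (bpres jk s) = bpres ik s
}.

Record zmodPresheaf := ZmodPresheaf {
  zpsec :> bidx B -> zmodType;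
  zpres : forall i j, B i `<=` B j -> {additive zpsec j -> zpsec i};
  zpres_id : forall i (ii : B i `<=` B i) s, zpres ii s = s;
  zpres_comp : forall i j k (ij : B i `<=` B j) (jk : B j `<=` B k)
    (ik : B i `<=` B k) s, zpres ij (zpres jk s) = zpres ik s
}.

Definition nmod_of_binoid (P : binoidPresheaf) : nmodPresheaf :=
  @NmodPresheaf (fun i => P i) (@bpres P) (@bpres_id P) (@bpres_comp P).

Definition nmod_of_zmod (P : zmodPresheaf) : nmodPresheaf :=
  @NmodPresheaf (fun i => P i) (@zpres P) (@zpres_id P) (@zpres_comp P).

End Presheaves.

(* For presheaves of binoids or of abelian groups, the sheaf condition only
   involves the underlying sets. *)
Section SheafCondition.
Variables (X : topologicalType) (P : nmodPresheaf (opens_base X)).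

Definition is_sheaf := forall (J : Type) (V : J -> opens X) (U : opens X)
    (VU : forall j, V j `<=` U), U `<=` \bigcup_j V j ->
  (forall s t : P U,
    (forall j, npres P (VU j) s = npres P (VU j) t) -> s = t) /\
  (forall s : forall j, P (V j),
    (forall j k, npres P (@opensIl _ (V j) (V k)) (s j) =
                 npres P (@opensIr _ (V j) (V k)) (s k)) ->
    exists t : P U, forall j, npres P (VU j) t = s j).

End SheafCondition.

Record binoidSheaf (X : topologicalType) := BinoidSheaf {
  bsheaf_presheaf :> binoidPresheaf (opens_base X);
  bsheafP : is_sheaf (nmod_of_binoid bsheaf_presheaf)
}.

Record zmodSheaf (X : topologicalType) := ZmodSheaf {
  zsheaf_presheaf :> zmodPresheaf (opens_base X);
  zsheafP : is_sheaf (nmod_of_zmod zsheaf_presheaf)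
}.

Record zmodSheaf_hom (X : topologicalType) (F G : zmodSheaf X) :=
  ZmodSheafHom {
    zhom :> forall U : opens X, {additive F U -> G U};
    zhom_nat : forall (U V : opens X) (UV : U `<=` V) (s : F V),
      zhom U (zpres F UV s) = zpres G UV (zhom V s)
  }.

Definition zmodSheaf_iso (X : topologicalType) (F G : zmodSheaf X) : Prop :=
  exists (phi : zmodSheaf_hom F G) (psi : zmodSheaf_hom G F),
    forall U : opens X, cancel (phi U) (psi U) /\ cancel (psi U) (phi U).

Section Stalk.
Variables (X : topologicalType) (B : base X) (P : nmodPresheaf B) (x : X).

Record pregerm := Pregerm { gidx : bidx B; gmem : B gidx x; gsec : P gidx }.

HB.instance Definition _ := gen_eqMixin pregerm.
HB.instance Definition _ := gen_choiceMixin pregerm.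

Definition germ_rel : rel pregerm := fun s t =>
  `[< exists k (ks : B k `<=` B (gidx s)) (kt : B k `<=` B (gidx t)),
        B k x /\ npres P ks (gsec s) = npres P kt (gsec t) >].

Fact germ_rel_refl : reflexive germ_rel.
Proof.
move=> s; apply/asboolP.
by exists (gidx s), (@subset_refl _ _), (@subset_refl _ _); split=> //;
   apply: gmem.
Qed.
Fact germ_rel_sym : symmetric germ_rel.
Proof.
move=> s t; apply/asboolP/asboolP => -[k [ks [kt [kx e]]]];
  by exists k, kt, ks; split.
Qed.
Fact germ_rel_trans : transitive germ_rel.
Proof.
move=> t s u /asboolP[k [ks [kt [kx e]]]] /asboolP[l [lt [lu [lx e']]]].
have [m [mx mk ml]] := base_nbhsI kx lx; apply/asboolP.
exists m, (subset_trans mk ks), (subset_trans ml lu); split=> //.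
rewrite -(npres_comp mk ks) e (npres_comp mk kt (subset_trans mk kt)).
by rewrite -(npres_comp ml lt) e' (npres_comp ml lu (subset_trans ml lu)).
Qed.

Canonical germ_equiv :=
  EquivRel germ_rel germ_rel_refl germ_rel_sym germ_rel_trans.

Definition stalk := {eq_quot germ_rel}.
HB.instance Definition _ := Choice.on stalk.
HB.instance Definition _ := EqQuotient.on stalk.

Definition germ (i : bidx B) (ix : B i x) (s : P i) : stalk :=
  \pi_stalk (Pregerm ix s).

Lemma germP i j (ix : B i x) (jx : B j x) (s : P i) (t : P j) :
  germ ix s = germ jx t <->
  exists k (ki : B k `<=` B i) (kj : B k `<=` B j),
    B k x /\ npres P ki s = npres P kj t.
Proof. by split=> [/eqmodP/asboolP//|h]; apply/eqmodP/asboolP. Qed.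

Lemma germ_res i j (ix : B i x) (jx : B j x) (ij : B i `<=` B j) (s : P j) :
  germ ix (npres P ij s) = germ jx s.
Proof.
apply/germP; exists i, (@subset_refl _ _), ij; split=> //.
by rewrite npres_id.
Qed.

Lemma stalkW (Q : stalk -> Prop) :
  (forall i (ix : B i x) s, Q (germ ix s)) -> forall a, Q a.
Proof. by move=> h a; rewrite -[a]reprK; case: (repr a) => i ix s; apply: h. Qed.

Lemma stalkW2 (Q : stalk -> stalk -> Prop) :
  (forall i (ix : B i x) s t, Q (germ ix s) (germ ix t)) -> forall a b, Q a b.
Proof.
move=> h; elim/stalkW=> i ix s; elim/stalkW=> j jx t.
have [k [kx ki kj]] := base_nbhsI ix jx.
by rewrite -(germ_res kx ix ki) -(germ_res kx jx kj); apply: h.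
Qed.

Lemma stalkW3 (Q : stalk -> stalk -> stalk -> Prop) :
  (forall i (ix : B i x) s t u, Q (germ ix s) (germ ix t) (germ ix u)) ->
  forall a b c, Q a b c.
Proof.
move=> h; apply: stalkW2 => i ix s t; elim/stalkW=> j jx u.
have [k [kx ki kj]] := base_nbhsI ix jx.
by rewrite -2!(germ_res kx ix ki) -(germ_res kx jx kj); apply: h.
Qed.

Lemma stalk_idx : {i : bidx B | B i x}.
Proof.
by apply: cid; have [i] := base_nbhs B openT (I : setT x); exists i.
Qed.

Definition stalk_zero : stalk := germ (proj2_sig stalk_idx) 0.

Lemma stalk_zeroE i (ix : B i x) : stalk_zero = germ ix 0.
Proof.
rewrite /stalk_zero; case: stalk_idx => j jx /=.
have [k [kx ki kj]] := base_nbhsI ix jx.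
by rewrite -(germ_res kx ix ki) -(germ_res kx jx kj) !raddf0.
Qed.

Definition stalk_add (a b : stalk) : stalk :=
  let: k := cid (base_nbhsI (gmem (repr a)) (gmem (repr b))) in
  let: And3 kx ki kj := proj2_sig k in
  germ kx (npres P ki (gsec (repr a)) + npres P kj (gsec (repr b))).

Lemma stalk_addE i (ix : B i x) (s t : P i) :
  stalk_add (germ ix s) (germ ix t) = germ ix (s + t).
Proof.
rewrite /stalk_add; case: cid => k [kx ki kj] /=.
have : germ (gmem (repr (germ ix s))) (gsec (repr (germ ix s))) = germ ix s.
  by rewrite -[RHS]reprK; congr (\pi_stalk _); case: (repr _).
have : germ (gmem (repr (germ ix t))) (gsec (repr (germ ix t))) = germ ix t.
  by rewrite -[RHS]reprK; congr (\pi_stalk _); case: (repr _).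
move: ki kj; case: (repr (germ ix s)) => /= m mx s'.
case: (repr (germ ix t)) => /= n nx t' km kn.
move=> /germP[p [pn [pi [px et]]]] /germP[q [qm [qi [qx es]]]].
have [r [rx rp rq]] := base_nbhsI px qx.
have [u [ux uk ur]] := base_nbhsI kx rx.
have up := subset_trans ur rp; have uq := subset_trans ur rq.
have ui := subset_trans up pi; have um := subset_trans uk km.
have un := subset_trans uk kn.
rewrite -(germ_res ux kx uk) -(germ_res ux ix ui) !raddfD; congr germ.
rewrite (npres_comp uk km um) (npres_comp uk kn un).
rewrite -(npres_comp uq qm um) es (npres_comp uq qi ui).
by rewrite -(npres_comp up pn un) et (npres_comp up pi ui).
Qed.

Fact stalk_addA : associative stalk_add.
Proof. by apply: stalkW3 => i ix s t u; rewrite !stalk_addE addrA. Qed.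
Fact stalk_addC : commutative stalk_add.
Proof. by apply: stalkW2 => i ix s t; rewrite !stalk_addE addrC. Qed.
Fact stalk_add0 : left_id stalk_zero stalk_add.
Proof.
by elim/stalkW=> i ix s; rewrite (stalk_zeroE ix) !stalk_addE add0r.
Qed.

HB.instance Definition _ :=
  GRing.isNmodule.Build stalk stalk_addA stalk_addC stalk_add0.

Lemma germD i (ix : B i x) (s t : P i) :
  germ ix (s + t) = germ ix s + germ ix t.
Proof. by rewrite -stalk_addE. Qed.

Lemma germ0 i (ix : B i x) : germ ix (0 : P i) = 0.
Proof. by rewrite -stalk_zeroE. Qed.

End Stalk.

Section StalkBinoid.
Variables (X : topologicalType) (B : base X) (P : binoidPresheaf B) (x : X).

Definition bstalk := stalk (nmod_of_binoid P) x.
HB.instance Definition _ := GRing.Nmodule.on bstalk.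

Definition bstalk_inf : bstalk :=
  germ (P := nmod_of_binoid P) (proj2_sig (stalk_idx B x)) (binf : P _).

Lemma bstalk_infE i (ix : B i x) :
  bstalk_inf = germ (P := nmod_of_binoid P) ix (binf : P i).
Proof.
rewrite /bstalk_inf; case: stalk_idx => j jx /=.
have [k [kx ki kj]] := base_nbhsI ix jx.
rewrite -(germ_res (P := nmod_of_binoid P) kx ix ki).
rewrite -(germ_res (P := nmod_of_binoid P) kx jx kj) /=.
by rewrite !bpres_inf.
Qed.

Fact bstalk_addinf (a : bstalk) : bstalk_inf + a = bstalk_inf.
Proof.
elim/stalkW: a => i ix s; rewrite (bstalk_infE ix) -[LHS]germD.
by rewrite [X in germ _ X]addinfr.
Qed.

HB.instance Definition _ := Nmodule_isBinoid.Build bstalk bstalk_addinf.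

End StalkBinoid.

Section StalkZmod.
Variables (X : topologicalType) (B : base X) (P : zmodPresheaf B) (x : X).

Definition zstalk := stalk (nmod_of_zmod P) x.
HB.instance Definition _ := GRing.Nmodule.on zstalk.

Definition zstalk_opp (a : zstalk) : zstalk :=
  germ (P := nmod_of_zmod P) (gmem (repr a)) (- (gsec (repr a) : P _)).

Lemma zstalk_oppE i (ix : B i x) (s : P i) :
  zstalk_opp (germ (P := nmod_of_zmod P) ix s) =
  germ (P := nmod_of_zmod P) ix (- s).
Proof.
rewrite /zstalk_opp.
set a := germ (P := nmod_of_zmod P) ix s.
have : germ (gmem (repr a)) (gsec (repr a)) = a.
  by rewrite -[RHS]reprK; congr (\pi_(stalk _ _) _); case: (repr _).
case: (repr a) => /= j jx t /germP[k [kj [ki [kx e]]]].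
apply/germP; exists k, kj, ki; split=> //.
by move: e; rewrite /= !raddfN => ->.
Qed.

Fact zstalk_addN : left_inverse 0 zstalk_opp +%R.
Proof.
elim/stalkW=> i ix s; rewrite zstalk_oppE -[LHS]germD.
by rewrite [X in germ _ X]addNr [LHS]germ0.
Qed.

HB.instance Definition _ := GRing.Nmodule_isZmodule.Build zstalk zstalk_addN.

End StalkZmod.

Section Sections.
Variables (X : topologicalType) (B : base X) (P : nmodPresheaf B).

(* Functions to the stalks that are locally given by the germs of a section of
   the presheaf over a member of the base. *)
Record sections (U : set X) := Sections {
  gval : forall x, U x -> stalk P x;
  gvalP : forall x, U x -> exists i (iU : B i `<=` U) (s : P i),
    B i x /\ forall y (iy : B i y), gval (iU y iy) = germ iy s
}.

Lemma sections_ext U (s t : sections U) :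
  (forall x (Ux : U x), gval s Ux = gval t Ux) -> s = t.
Proof.
case: s t => [s sP] [t tP] /= st.
have e : s = t.
  by apply: functional_extensionality_dep => x;
     apply: functional_extensionality_dep => Ux; apply: st.
by move: sP; rewrite e => sP; congr Sections; apply: Prop_irrelevance.
Qed.

Section Operations.
Variable U : set X.

HB.instance Definition _ := gen_eqMixin (sections U).
HB.instance Definition _ := gen_choiceMixin (sections U).

End Operations.

Section Operations.
Variable U : opens X.

Fact sections_zeroP x : oset U x -> exists i (iU : B i `<=` U) (s : P i),
  B i x /\ forall y (iy : B i y), (0 : stalk P y) = germ iy s.
Proof.
move=> Ux; have [i ix iU] := base_nbhs B (oset_open U) Ux.
by exists i, iU, 0; split=> // y iy; rewrite germ0.
Qed.

Definition sections_zero : sections U :=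
  @Sections U (fun x _ => 0) sections_zeroP.

Fact sections_addP (s t : sections U) x : oset U x ->
  exists i (iU : B i `<=` U) (r : P i),
  B i x /\ forall y (iy : B i y),
    gval s (iU y iy) + gval t (iU y iy) = germ iy r.
Proof.
move=> Ux; have [i [iU [a [ix ha]]]] := gvalP s Ux.
have [j [jU [b [jx hb]]]] := gvalP t Ux.
have [k [kx ki kj]] := base_nbhsI ix jx.
exists k, (subset_trans ki iU), (npres P ki a + npres P kj b); split=> // y ky.
rewrite germD (germ_res ky (ki _ ky)) (germ_res ky (kj _ ky)) -ha -hb.
by congr (gval s _ + gval t _); apply: Prop_irrelevance.
Qed.

Definition sections_add (s t : sections U) : sections U :=
  @Sections U (fun x Ux => gval s Ux + gval t Ux) (@sections_addP s t).

Fact sections_addA : associative sections_add.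
Proof. by move=> s t u; apply: sections_ext => x Ux /=; rewrite addrA. Qed.
Fact sections_addC : commutative sections_add.
Proof. by move=> s t; apply: sections_ext => x Ux /=; rewrite addrC. Qed.
Fact sections_add0 : left_id sections_zero sections_add.
Proof. by move=> s; apply: sections_ext => x Ux /=; rewrite add0r. Qed.

HB.instance Definition _ := GRing.isNmodule.Build (sections U)
  sections_addA sections_addC sections_add0.

End Operations.

Section Restriction.
Variables (U V : set X) (oU : open U) (UV : U `<=` V).

Fact sections_resP (s : sections V) x : U x ->
  exists i (iU : B i `<=` U) (r : P i),
  B i x /\ forall y (iy : B i y), gval s (UV (iU y iy)) = germ iy r.
Proof.
move=> Ux; have [i [iV [a [ix ha]]]] := gvalP s (UV Ux).
have [j jx jU] := base_nbhs B oU Ux.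
have [k [kx ki kj]] := base_nbhsI ix jx.
exists k, (subset_trans kj jU), (npres P ki a); split=> // y ky.
rewrite (germ_res ky (ki _ ky)) -ha.
by congr (gval s _); apply: Prop_irrelevance.
Qed.

Definition sections_res (s : sections V) : sections U :=
  @Sections U (fun x Ux => gval s (UV Ux)) (@sections_resP s).

End Restriction.

Fact sections_res_is_additive (U V : opens X) (UV : U `<=` V) :
  nmod_morphism (sections_res (oset_open U) UV : sections V -> sections U).
Proof.
by split; [apply: sections_ext|move=> s t; apply: sections_ext].
Qed.

HB.instance Definition _ (U V : opens X) (UV : U `<=` V) :=
  GRing.isNmodMorphism.Build (sections V) (sections U)
    (sections_res (oset_open U) UV) (@sections_res_is_additive U V UV).

End Sections.

Section SectionsBinoid.
Variables (X : topologicalType) (B : base X) (P : binoidPresheaf B).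

Definition bsections (U : set X) := sections (nmod_of_binoid P) U.

Section Structure.
Variable U : opens X.

HB.instance Definition _ := GRing.Nmodule.on (bsections U).

Fact bsections_infP x : oset U x ->
  exists i (iU : B i `<=` U) (s : nmod_of_binoid P i),
  B i x /\ forall y (iy : B i y), (binf : bstalk P y) = germ iy s.
Proof.
move=> Ux; have [i ix iU] := base_nbhs B (oset_open U) Ux.
by exists i, iU, (binf : P i); split=> // y iy; apply: bstalk_infE.
Qed.

Definition bsections_inf : bsections U :=
  @Sections _ _ _ U (fun x _ => (binf : bstalk P x)) bsections_infP.

Fact bsections_addinf (s : bsections U) : bsections_inf + s = bsections_inf.
Proof.
apply: sections_ext => x Ux /=.
exact: (addinfr (gval s Ux : bstalk P x)).
Qed.

HB.instance Definition _ :=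
  Nmodule_isBinoid.Build (bsections U) bsections_addinf.

End Structure.

Definition bsections_res (U V : opens X) (UV : U `<=` V) :
  bsections V -> bsections U := sections_res (oset_open U) UV.

HB.instance Definition _ (U V : opens X) (UV : U `<=` V) :=
  GRing.isNmodMorphism.Build (bsections V) (bsections U) (bsections_res UV)
    (@sections_res_is_additive _ _ (nmod_of_binoid P) U V UV).

End SectionsBinoid.

Section SectionsZmod.
Variables (X : topologicalType) (B : base X) (P : zmodPresheaf B).

Definition zsections (U : set X) := sections (nmod_of_zmod P) U.

Section Structure.
Variable U : opens X.

HB.instance Definition _ := GRing.Nmodule.on (zsections U).

Fact zsections_oppP (s : zsections U) x : oset U x ->
  exists i (iU : B i `<=` U) (r : nmod_of_zmod P i),
  B i x /\ forall y (iy : B i y),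
    - (gval s (iU y iy) : zstalk P y) = germ iy r.
Proof.
move=> Ux; have [i [iU [a [ix ha]]]] := gvalP s Ux.
exists i, iU, (- (a : P i)); split=> // y iy.
by rewrite ha [LHS]zstalk_oppE.
Qed.

Definition zsections_opp (s : zsections U) : zsections U :=
  @Sections _ _ _ U (fun x Ux => - (gval s Ux : zstalk P x)) (zsections_oppP s).

Fact zsections_addN : left_inverse 0 zsections_opp +%R.
Proof.
move=> s; apply: sections_ext => x Ux /=.
exact: (addNr (gval s Ux : zstalk P x)).
Qed.

HB.instance Definition _ :=
  GRing.Nmodule_isZmodule.Build (zsections U) zsections_addN.

End Structure.

Definition zsections_res (U V : opens X) (UV : U `<=` V) :
  zsections V -> zsections U := sections_res (oset_open U) UV.

HB.instance Definition _ (U V : opens X) (UV : U `<=` V) :=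
  GRing.isNmodMorphism.Build (zsections V) (zsections U) (zsections_res UV)
    (@sections_res_is_additive _ _ (nmod_of_zmod P) U V UV).

End SectionsZmod.

Section SectionsGlue.
Variables (X : topologicalType) (B : base X) (P : nmodPresheaf B).
Variables (J : Type) (V : J -> opens X) (U : opens X).
Hypotheses (VU : forall j, V j `<=` U) (UV : U `<=` \bigcup_j V j).

Lemma sections_separated (s t : sections P U) :
  (forall j, sections_res (oset_open (V j)) (@VU j) s =
             sections_res (oset_open (V j)) (@VU j) t) -> s = t.
Proof.
move=> st; apply: sections_ext => x Ux; have [j _ jx] := UV Ux.
have := congr1 (fun r => gval r jx) (st j).
by rewrite /= (Prop_irrelevance (VU jx) Ux).
Qed.

Lemma sections_glue (s : forall j, sections P (V j)) :
  (forall j k,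
    sections_res (oset_open (opensI (V j) (V k))) (@opensIl _ (V j) (V k)) (s j) =
    sections_res (oset_open (opensI (V j) (V k))) (@opensIr _ (V j) (V k)) (s k)) ->
  exists t : sections P U,
    forall j, sections_res (oset_open (V j)) (@VU j) t = s j.
Proof.
move=> compat.
have sE j k x (jx : oset (V j) x) (kx : oset (V k) x) :
    gval (s j) jx = gval (s k) kx.
  have jkx : oset (opensI (V j) (V k)) x by [].
  have := congr1 (fun r => gval r jkx) (compat j k).
  rewrite /= (Prop_irrelevance (opensIl jkx) jx).
  by rewrite (Prop_irrelevance (opensIr jkx) kx).
have cover x : oset U x -> {j | oset (V j) x}.
  by move=> Ux; apply: cid; have [j _ jx] := UV Ux; exists j.
pose g x (Ux : oset U x) := gval (s (sval (cover x Ux))) (proj2_sig (cover x Ux)).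
have gP x : oset U x -> exists i (iU : B i `<=` U) (r : P i),
    B i x /\ forall y (iy : B i y), g y (iU y iy) = germ iy r.
  move=> Ux; have [j _ jx] := UV Ux.
  have [i [iV [a [ix ha]]]] := gvalP (s j) jx.
  exists i, (subset_trans iV (@VU j)), a; split=> // y iy.
  by rewrite -ha; apply: sE.
by exists (Sections gP) => j; apply: sections_ext => x jx; apply: sE.
Qed.

End SectionsGlue.

Section BinoidSheafification.
Variables (X : topologicalType) (B : base X) (P : binoidPresheaf B).

Program Definition bsheafify_presheaf : binoidPresheaf (opens_base X) :=
  @BinoidPresheaf _ (opens_base X) (fun U : opens X => bsections P U)
    (fun U V UV => @bsections_res _ _ P U V UV) _ _ _.
Next Obligation. by move=> U V UV; apply: sections_ext. Qed.
Next Obligation.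
move=> U UU s; apply: sections_ext => x Ux /=.
by congr (gval s _); apply: Prop_irrelevance.
Qed.
Next Obligation.
move=> U V W UV VW UW s; apply: sections_ext => x Ux /=.
by congr (gval s _); apply: Prop_irrelevance.
Qed.

Lemma bsheafify_is_sheaf : is_sheaf (nmod_of_binoid bsheafify_presheaf).
Proof.
move=> J V U VU UV; split.
- exact: sections_separated UV.
- exact: sections_glue UV.
Qed.

Definition bsheafify : binoidSheaf X := BinoidSheaf bsheafify_is_sheaf.

End BinoidSheafification.

Section ZmodSheafification.
Variables (X : topologicalType) (B : base X) (P : zmodPresheaf B).

Program Definition zsheafify_presheaf : zmodPresheaf (opens_base X) :=
  @ZmodPresheaf _ (opens_base X) (fun U : opens X => zsections P U)
    (fun U V UV => @zsections_res _ _ P U V UV) _ _.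
Next Obligation.
move=> U UU s; apply: sections_ext => x Ux /=.
by congr (gval s _); apply: Prop_irrelevance.
Qed.
Next Obligation.
move=> U V W UV VW UW s; apply: sections_ext => x Ux /=.
by congr (gval s _); apply: Prop_irrelevance.
Qed.

Lemma zsheafify_is_sheaf : is_sheaf (nmod_of_zmod zsheafify_presheaf).
Proof.
move=> J V U VU UV; split.
- exact: sections_separated UV.
- exact: sections_glue UV.
Qed.

Definition zsheafify : zmodSheaf X := ZmodSheaf zsheafify_is_sheaf.

End ZmodSheafification.

Definition loc_presheaf (M : binoidType) : binoidPresheaf (spec_base M) :=
  @BinoidPresheaf _ (spec_base M) (fun f : M => loc f)
    (fun f g fg => @loc_res M f g fg)
    (fun f g fg => @loc_res_inf M f g fg) (@loc_res_id M) (@loc_res_comp M).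

Definition structure_sheaf (M : binoidType) : binoidSheaf (spec M) :=
  bsheafify (loc_presheaf M).

Section UnitSheaf.
Variables (X : topologicalType) (O : binoidSheaf X).

Program Definition units_presheaf : zmodPresheaf (opens_base X) :=
  @ZmodPresheaf _ (opens_base X) (fun U : opens X => units (O U))
    (fun U V UV => units_map (bpres O UV)) _ _.
Next Obligation.
by move=> U UU s; apply/val_inj; rewrite /= bpres_id.
Qed.
Next Obligation.
by move=> U V W UV VW UW s; apply/val_inj; rewrite /= (bpres_comp UV VW UW).
Qed.

Lemma units_is_sheaf : is_sheaf (nmod_of_zmod units_presheaf).
Proof.
move=> J V U VU UV; have [sep glue] := bsheafP O VU UV; split.
  move=> s t st; apply/val_inj; apply: sep => j.
  exact: (congr1 (@uval _) (st j)).
move=> s compat.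
have [t tE] : exists t : O U, forall j, bpres O (VU j) t = uval (s j).
  by apply: glue => j k; apply: (congr1 (@uval _) (compat j k)).
have [t' t'E] : exists t : O U, forall j, bpres O (VU j) t = uval (- s j).
  apply: glue => j k.
  have e : units_map (bpres O (@opensIl _ (V j) (V k))) (s j) =
           units_map (bpres O (@opensIr _ (V j) (V k))) (s k) := compat j k.
  by have := congr1 (fun u => uval (- u)) e; rewrite -!raddfN.
have tU : t \in @is_unit (O U).
  apply/is_unitP; exists t'; apply: sep => j /=.
  by rewrite raddfD raddf0 tE t'E; apply: (congr1 (@uval _) (subrr (s j))).
by exists (Units tU) => j; apply/val_inj; rewrite /= tE.
Qed.

Definition units_sheaf : zmodSheaf X := ZmodSheaf units_is_sheaf.

End UnitSheaf.

Section ExtensionByZero.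
Variables (X : topologicalType) (D : set X).

(* Z if b, else the trivial group. *)
Definition ext_group (b : bool) : zmodType := if b then (int : zmodType) else ('I_1 : zmodType).

Definition ext_map (b b' : bool) : ext_group b -> ext_group b' :=
  match b, b' return ext_group b -> ext_group b' with
  | true, true => id
  | _, _ => fun=> 0
  end.

Fact ext_map_is_additive b b' : nmod_morphism (@ext_map b b').
Proof. by case: b b' => -[] /=; split=> // x y; rewrite addr0. Qed.

HB.instance Definition _ b b' := GRing.isNmodMorphism.Build
  (ext_group b) (ext_group b') (@ext_map b b') (@ext_map_is_additive b b').

Lemma ext_map_id b (s : ext_group b) : ext_map b s = s.
Proof. by case: b s => // s; rewrite [s]ord1. Qed.

Lemma ext_map_comp (b b' b'' : bool) (s : ext_group b) : (b -> b') ->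
  ext_map b'' (ext_map b' s) = ext_map b'' s.
Proof. by case: b b' b'' s => -[] [] // s /(_ isT). Qed.

Program Definition ext_presheaf : zmodPresheaf (opens_base X) :=
  @ZmodPresheaf _ (opens_base X)
    (fun U : opens X => ext_group `[< U `<=` D >])
    (fun U V UV => @ext_map `[< V `<=` D >] `[< U `<=` D >]) _ _.
Next Obligation. by move=> U UU s; apply: ext_map_id. Qed.
Next Obligation.
move=> U V W UV VW UW s; apply: ext_map_comp => /asboolP WD.
by apply/asboolP; apply: subset_trans VW WD.
Qed.

Definition ext_sheaf : zmodSheaf X := zsheafify ext_presheaf.

End ExtensionByZero.

Section DirectSumGroup.
Variables (I : finType) (A : I -> zmodType).

Definition dsum := {dffun forall i, A i}.
HB.instance Definition _ := Choice.on dsum.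

Definition dsum_add (s t : dsum) : dsum := [ffun i => s i + t i].
Definition dsum_zero : dsum := [ffun i => 0].
Definition dsum_opp (s : dsum) : dsum := [ffun i => - s i].

Fact dsum_addA : associative dsum_add.
Proof. by move=> s t u; apply/ffunP => i; rewrite !ffunE addrA. Qed.
Fact dsum_addC : commutative dsum_add.
Proof. by move=> s t; apply/ffunP => i; rewrite !ffunE addrC. Qed.
Fact dsum_add0 : left_id dsum_zero dsum_add.
Proof. by move=> s; apply/ffunP => i; rewrite !ffunE add0r. Qed.
Fact dsum_addN : left_inverse dsum_zero dsum_opp dsum_add.
Proof. by move=> s; apply/ffunP => i; rewrite !ffunE addNr. Qed.

HB.instance Definition _ :=
  GRing.isZmodule.Build dsum dsum_addA dsum_addC dsum_add0 dsum_addN.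

End DirectSumGroup.

Section DirectSumMap.
Variables (I : finType) (A A' : I -> zmodType).
Variable f : forall i, {additive A i -> A' i}.

Definition dsum_map (s : dsum A) : dsum A' := [ffun i => f i (s i)].

Fact dsum_map_is_additive : nmod_morphism dsum_map.
Proof.
split; first by apply/ffunP => i; rewrite !ffunE raddf0.
by move=> s t; apply/ffunP => i; rewrite !ffunE raddfD.
Qed.

HB.instance Definition _ := GRing.isNmodMorphism.Build (dsum A) (dsum A')
  dsum_map dsum_map_is_additive.

End DirectSumMap.

(* The index set being finite, the direct sum of sheaves is computed
   sectionwise, without sheafifying. *)
Section DirectSum.
Variables (X : topologicalType) (I : finType) (F : I -> zmodSheaf X).

Program Definition dsum_presheaf : zmodPresheaf (opens_base X) :=
  @ZmodPresheaf _ (opens_base X) (fun U : opens X => dsum (fun i => F i U))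
    (fun U V UV => dsum_map (fun i => zpres (F i) UV)) _ _.
Next Obligation.
by move=> U UU s; apply/ffunP => i; rewrite ffunE zpres_id.
Qed.
Next Obligation.
by move=> U V W UV VW UW s; apply/ffunP => i;
   rewrite !ffunE (zpres_comp UV VW UW).
Qed.

Lemma dsum_is_sheaf : is_sheaf (nmod_of_zmod dsum_presheaf).
Proof.
move=> J V U VU UV; split.
  move=> s t st; apply/ffunP => i.
  have [sep _] := zsheafP (F i) VU UV; apply: sep => j.
  have e : dsum_map (fun i => zpres (F i) (VU j)) s =
           dsum_map (fun i => zpres (F i) (VU j)) t := st j.
  by have := congr1 (fun r : dsum _ => r i) e; rewrite !ffunE.
move=> s compat.
have glue i : exists t : F i U, forall j,
    zpres (F i) (VU j) t = (s j : dsum (fun i => F i (V j))) i.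
  have [_ glue] := zsheafP (F i) VU UV.
  apply: (glue (fun j => (s j : dsum (fun i => F i (V j))) i)) => j k.
  have e : dsum_map (fun i => zpres (F i) (@opensIl _ (V j) (V k))) (s j) =
           dsum_map (fun i => zpres (F i) (@opensIr _ (V j) (V k))) (s k) :=
    compat j k.
  by have := congr1 (fun r : dsum _ => r i) e; rewrite !ffunE.
exists ([ffun i => sval (cid (glue i))] : dsum (fun i => F i U)) => j.
apply/ffunP => i; rewrite !ffunE.
by case: cid => t /= ->.
Qed.

Definition dsum_sheaf : zmodSheaf X := ZmodSheaf dsum_is_sheaf.

End DirectSum.

Definition vertex_sheaf (V : finType) (K : simplicial_complex V) (v : V) :
    zmodSheaf (spec (simplicial_binoid K)) :=
  ext_sheaf (specD (sgen K v)).

(* Main.v *)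
(** Both sheaves are identified with the sheaf of families (h_v)_v of locally
    constant integer functions such that h_v vanishes off D(x_v). For the
    direct sum, h_v is the value of the germ in the stalk, which is Z on D(x_v)
    and 0 elsewhere. For the units, a germ a - m f at p with a, f outside p has
    at v the exponent of x_v in a minus m times that in f; this is well
    defined and injective, since an element of M other than oo is a unique
    monomial. Conversely every family is realised because p has a smallest
    neighbourhood D(f), f the sum of the x_v outside p, and M_f contains the needed unit. *)

Require Import Defs.
From HB Require Import structures.
From mathcomp Require Import all_boot all_order all_algebra.
From mathcomp Require Import all_classical topology.

Set Implicit Arguments.
Unset Strict Implicit.
Unset Printing Implicit Defensive.

Import Order.TTheory GRing.Theory Num.Theory.
Local Open Scope ring_scope.
Local Open Scope classical_set_scope.
Local Open Scope quotient_scope.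

(** * Isomorphisms between sheaves whose sections are determined by values *)

Section IsoByValues.
Variables (X : topologicalType) (F G : zmodSheaf X) (I : Type) (T : zmodType).
Variables (a : forall U : opens X, F U -> forall x, oset U x -> I -> T)
          (b : forall U : opens X, G U -> forall x, oset U x -> I -> T).
Hypotheses
  (aD : forall U (s t : F U) x (Ux : oset U x) i,
    a (s + t) Ux i = a s Ux i + a t Ux i)
  (bD : forall U (s t : G U) x (Ux : oset U x) i,
    b (s + t) Ux i = b s Ux i + b t Ux i)
  (a_res : forall (U V : opens X) (UV : U `<=` V) (s : F V) x (Ux : oset U x) i,
    a (zpres F UV s) Ux i = a s (UV x Ux) i)
  (b_res : forall (U V : opens X) (UV : U `<=` V) (s : G V) x (Ux : oset U x) i,
    b (zpres G UV s) Ux i = b s (UV x Ux) i)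
  (a_inj : forall U (s t : F U),
    (forall x (Ux : oset U x) i, a s Ux i = a t Ux i) -> s = t)
  (b_inj : forall U (s t : G U),
    (forall x (Ux : oset U x) i, b s Ux i = b t Ux i) -> s = t)
  (ab : forall U (s : F U),
    exists t : G U, forall x (Ux : oset U x) i, b t Ux i = a s Ux i)
  (ba : forall U (t : G U),
    exists s : F U, forall x (Ux : oset U x) i, a s Ux i = b t Ux i).

(** Values determine sections, so a section of the other sheaf with the same values is unique;
    additivity, naturality and mutual inverseness follow by comparing values. *)
Lemma zmodSheaf_iso_by_values : zmodSheaf_iso F G.
Proof.
pose f (U : opens X) (s : F U) : G U := sval (cid (ab s)).
have fE U s x (Ux : oset U x) i : b (f U s) Ux i = a s Ux i.
  by rewrite /f; case: cid.
pose g (U : opens X) (t : G U) : F U := sval (cid (ba t)).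
have gE U t x (Ux : oset U x) i : a (g U t) Ux i = b t Ux i.
  by rewrite /g; case: cid.
have fD U : nmod_morphism (f U).
  have fD s t : f U (s + t) = f U s + f U t.
    by apply: b_inj => x Ux i; rewrite bD !fE aD.
  by split=> //; apply: (addrI (f U 0)); rewrite -fD !addr0.
have gD U : nmod_morphism (g U).
  have gD s t : g U (s + t) = g U s + g U t.
    by apply: a_inj => x Ux i; rewrite aD !gE bD.
  by split=> //; apply: (addrI (g U 0)); rewrite -gD !addr0.
pose f' U : {additive F U -> G U} := HB.pack (f U)
  (GRing.isNmodMorphism.Build (F U) (G U) (f U) (fD U)).
pose g' U : {additive G U -> F U} := HB.pack (g U)
  (GRing.isNmodMorphism.Build (G U) (F U) (g U) (gD U)).
have f_nat (U V : opens X) (UV : U `<=` V) s :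
    f' U (zpres F UV s) = zpres G UV (f' V s).
  by apply: b_inj => x Ux i; rewrite fE a_res b_res fE.
have g_nat (U V : opens X) (UV : U `<=` V) s :
    g' U (zpres G UV s) = zpres F UV (g' V s).
  by apply: a_inj => x Ux i; rewrite gE a_res b_res gE.
exists (ZmodSheafHom f_nat), (ZmodSheafHom g_nat) => U; split=> s /=.
- by apply: a_inj => x Ux i; rewrite gE fE.
- by apply: b_inj => x Ux i; rewrite fE gE.
Qed.

End IsoByValues.

(** The clause on [c] expresses vanishing off [D], in the form that matches [ext_presheaf], whose
    sections over [W] are zero unless [W] lies in [D]. *)
Definition locally_constant_on (X : topologicalType) (D U : set X)
    (h : forall x, U x -> int) : Prop :=
  forall x, U x -> exists (W : opens X) (WU : W `<=` U) (c : int),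
    [/\ oset W x, forall y (Wy : oset W y), h y (WU y Wy) = c
      & c != 0 -> W `<=` D].

(** * Integer values of sections of the extension by zero *)

Section ExtensionByZeroValues.
Variables (X : topologicalType) (D : set X).

Definition ext_val (x : X) (t : zstalk (ext_presheaf D) x) : int :=
  ext_map true (gsec (repr t) : ext_group _).

(** Restriction to a smaller open set keeps the integer: if [W] lies in [D] so does the smaller set,
    and otherwise the section is already 0. *)
Lemma ext_valE (x : X) (W : opens X) (Wx : oset W x)
    (s : ext_group `[< W `<=` D >]) :
  ext_val (germ (P := nmod_of_zmod (ext_presheaf D)) (i := W) Wx s) =
  ext_map true s.
Proof.
rewrite /ext_val.
set t := germ _ _.
have : germ (gmem (repr t)) (gsec (repr t)) = t.
  by rewrite -[RHS]reprK; congr (\pi_(stalk _ _) _); case: (repr _).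
case: (repr t) => /= U Ux r /germP[k [kU [kW [kx /= e]]]].
have := congr1 (ext_map true) e.
by rewrite !ext_map_comp // => /asboolP h; apply/asboolP;
  [apply: subset_trans kW h | apply: subset_trans kU h].
Qed.

Lemma ext_valD (x : X) (s t : zstalk (ext_presheaf D) x) :
  ext_val (s + t) = ext_val s + ext_val t.
Proof.
move: s t; apply: stalkW2 => W Wx s t.
by rewrite -germD !ext_valE [LHS]raddfD.
Qed.

Lemma ext_val_inj (x : X) : injective (@ext_val x).
Proof.
apply: stalkW2 => W Wx s t; rewrite !ext_valE => e; congr germ.
move: s t e => /=; case: `[< _ >] => //= s t _.
by rewrite [s]ord1 [t]ord1.
Qed.

Lemma ext_sheaf_locally_constant (U : opens X) (s : ext_sheaf D U) :
  locally_constant_on D (fun x (Ux : oset U x) => ext_val (gval s Ux)).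
Proof.
move=> x Ux; have [W [WU [r [Wx hr]]]] := gvalP s Ux.
exists W, WU, (ext_map true (r : ext_group _)); split=> //.
  by move=> y Wy; rewrite hr ext_valE.
by move: r {hr} => /=; case: asboolP.
Qed.

(** Germs are chosen point by point; near each point they come from one section, since by
    [ext_val_inj] the value decides the germ. *)
Lemma ext_sheaf_onto (U : opens X) (h : forall x, oset U x -> int) :
  locally_constant_on D h ->
  exists s : ext_sheaf D U,
    forall x (Ux : oset U x), ext_val (gval s Ux) = h x Ux.
Proof.
move=> hP.
have ex (W : opens X) (c : int) : (c != 0 -> W `<=` D) ->
    exists r : ext_group `[< W `<=` D >], ext_map true r = c.
  (* When [W] is not inside [D], this is 0 and [cW] forces [c = 0]. *)
  move=> cW; exists (ext_map (b := true) _ (c : int)).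
  case: asboolP => //= nW; apply/esym/eqP/negbNE/negP => /cW; exact: nW.
have tP x (Ux : oset U x) : {t | @ext_val x t = h x Ux}.
  apply: cid; have [W [WU [c [Wx hc cW]]]] := hP x Ux.
  have [r rc] := ex W c cW.
  exists (germ (P := nmod_of_zmod (ext_presheaf D)) (i := W) Wx r).
  by rewrite ext_valE rc -(hc x Wx); congr (h _ _); apply: Prop_irrelevance.
have sP x : oset U x -> exists i (iU : opens_base X i `<=` U)
    (r : nmod_of_zmod (ext_presheaf D) i), opens_base X i x /\
    forall y (iy : opens_base X i y), sval (tP y (iU y iy)) = germ iy r.
  move=> Ux; have [W [WU [c [Wx hc cW]]]] := hP x Ux.
  have [r rc] := ex W c cW.
  exists W, WU, r; split=> // y Wy; apply: ext_val_inj.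
  by rewrite ext_valE rc; case: tP => /= t ->.
exists (@Sections _ _ (nmod_of_zmod (ext_presheaf D)) U
  (fun x Ux => sval (tP x Ux)) sP) => x Ux /=.
by case: (tP x Ux).
Qed.

End ExtensionByZeroValues.

(** * Germs of fractions at a prime ideal *)

Section LocalizationStalk.
Variables (M : binoidType) (p : spec M).

Lemma specDX (f : M) n : specD f p -> specD (f *+ n) p.
Proof.
move=> fp; elim: n => [|n IHn]; first by rewrite mulr0n specD0.
by rewrite mulrS specDI.
Qed.

Lemma specD_sum (I : finType) (F : I -> M) :
  (forall i, specD (F i) p) -> specD (\sum_i F i) p.
Proof.
move=> FP; apply: (big_ind (fun f => specD f p)) => //; first by rewrite specD0.
by move=> f g fp gp; rewrite specDI.
Qed.

Definition germ_frac (f : M) (fp : specD f p) (a : M) (m : nat) :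
    bstalk (loc_presheaf M) p :=
  germ (P := nmod_of_binoid (loc_presheaf M)) (i := f) fp (Defs.frac f a m).

Lemma germ_fracW (Q : bstalk (loc_presheaf M) p -> Prop) :
  (forall f (fp : specD f p) a m, Q (germ_frac fp a m)) -> forall t, Q t.
Proof. by move=> h; elim/stalkW=> f fp; elim/Defs.fracW=> a m; apply: h. Qed.

Lemma germ_fracW2
    (Q : bstalk (loc_presheaf M) p -> bstalk (loc_presheaf M) p -> Prop) :
  (forall f (fp : specD f p) a m b n, Q (germ_frac fp a m) (germ_frac fp b n)) ->
  forall s t, Q s t.
Proof.
move=> h; apply: stalkW2 => f fp; elim/Defs.fracW=> a m; elim/Defs.fracW=> b n.
exact: h.
Qed.

Lemma germ_fracD (f : M) (fp : specD f p) a m b n :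
  germ_frac fp a m + germ_frac fp b n = germ_frac fp (a + b) (m + n).
Proof. by rewrite -[LHS]germD; congr germ; apply: loc_addE. Qed.

Lemma germ_frac0 (f : M) (fp : specD f p) : germ_frac fp 0 0 = 0.
Proof. exact: germ0. Qed.

Lemma germ_frac_eq (f g : M) (fp : specD f p) (gp : specD g p) a m b n :
  germ_frac fp a m = germ_frac gp b n ->
  exists2 h, specD h p & a + g *+ n + h = b + f *+ m + h.
Proof.
move=> /germP[k [kf [kg [kp /= e]]]].
have [[i c] /= ic] := specD_sub kf; have [[j d] /= jd] := specD_sub kg.
move: e; rewrite (loc_resE _ _ _ ic) (loc_resE _ _ _ jd) => /Defs.fracP[l e].
have cp : specD c p.
  by have := specDX (n := i) kp; rewrite ic specDI => -[].
have dp : specD d p.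
  by have := specDX (n := j) kp; rewrite jd specDI => -[].
(* Substituting [k *+ i = f + c] and [k *+ j = g + d] in [e] leaves exactly these summands common to
   both sides. *)
exists (c *+ m + d *+ n + k *+ l).
  by rewrite !specDI; split; [split|]; apply: specDX.
move: e; rewrite !mulrnDr !mulrnA ic jd !mulrnDl => e.
by rewrite [LHS](AC (2*3) (1*3*(2*4*5))) [RHS](AC (2*3) (1*4*(2*3*5))).
Qed.

Lemma eq_germ_frac (f : M) (fp : specD f p) a m b n :
  a + f *+ n = b + f *+ m -> germ_frac fp a m = germ_frac fp b n.
Proof. by move=> e; congr germ; apply/Defs.fracP; exists 0%N; rewrite !addn0. Qed.

(** Clearing denominators makes the numerator a summand of an element outside the ideal [p]. [key]
    does this for a fraction sharing its denominator with the inverse; [germ_frac_eq] then carries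
    the result back to [a]. *)
Lemma germ_frac_unit (f : M) (fp : specD f p) a m t :
  germ_frac fp a m + t = 0 -> specD a p.
Proof.
have key s r : s + r = 0 -> exists g (gp : specD g p) b n,
    s = germ_frac gp b n /\ specD b p.
  move: s r; apply: germ_fracW2 => g gp b n c k.
  rewrite germ_fracD -(germ_frac0 gp) => /germ_frac_eq[h hp].
  rewrite mulr0n addr0 => e; exists g, gp, b, n; split=> //.
  have : specD (b + c + h) p.
    by rewrite e !specDI; split=> //; split; [rewrite specD0|apply: specDX].
  by rewrite !specDI => -[[]].
move=> /key[g [gp [b [n [/germ_frac_eq[h hp /esym eh] bp]]]]].
have : specD (b + f *+ m + h) p.
  by rewrite !specDI; do !split=> //; apply: specDX.
by rewrite eh !specDI => -[[]].
Qed.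

End LocalizationStalk.

(** * Unique exponents of elements of the simplicial binoid *)

Section SimplicialExponents.
Variables (V : finType) (K : simplicial_complex V).
Local Notation M := (simplicial_binoid K).

Definition monomial (k : {ffun V -> nat}) : M := \pi_M (Some k).

(* Meaningful only for [a <> binf], where the representative is unique. *)
Definition exponent (a : M) (v : V) : nat :=
  if repr a is Some k then k v else 0%N.

(* All relations have right-hand side [binf], so "equal, or both sent to
   [binf]" is already a congruence containing them. *)
Lemma simplicial_rel_collapse (a b : free_binoid V) :
  gen_cong (simplicial_rel K) a b -> a = b \/ \pi_M a = binf.
Proof.
pose E (x y : free_binoid V) :=
  x = y \/ (\pi_M x = binf /\ \pi_M y = binf).
have infP (x : free_binoid V) c : \pi_M x = binf -> \pi_M (c + x) = binf.
  by move=> e; rewrite -[LHS]bquot_addE [X in bquot_add _ X]e; apply: addrinf.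
suff : gen_cong (simplicial_rel K) a b -> E a b by move=> h /h[|[]]; [left|right].
move/asboolP; apply.
- split.
  + by move=> x; left.
  + by move=> x y [->|[ex ey]]; [left|right].
  + by move=> x y z [->|[ex ey]] // [<-|[ey' ez]]; right.
  + by move=> x y z [->|[ex ey]]; [left|right; split; apply: infP].
- move=> x y R; right.
  have -> : y = binf by case: R => H _ [].
  split=> //; apply/bquotP/asboolP => E' cE RE; apply: RE.
  by case: R => H HK [-> _]; exists H.
Qed.

Lemma monomialD k l : monomial (k + l) = monomial k + monomial l.
Proof. by rewrite [RHS]bquot_addE. Qed.

Lemma monomial_exponent a : a <> binf -> monomial [ffun v => exponent a v] = a.
Proof.
move=> an; rewrite /monomial /exponent.
have := reprK a; case: (repr a) => [k|] e; last by case: an; rewrite -e.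
by rewrite -[RHS]e; congr (\pi_M (Some _)); apply/ffunP => v; rewrite ffunE.
Qed.

(** By [simplicial_rel_collapse], a class other than [binf] contains a single exponent vector. *)
Lemma exponent_monomial k v : monomial k <> binf -> exponent (monomial k) v = k v.
Proof.
move=> kn; rewrite /exponent.
have /bquotP : \pi_M (repr (monomial k)) = \pi_M (Some k) by rewrite reprK.
by case/simplicial_rel_collapse => [-> //|]; rewrite reprK.
Qed.

Lemma exponent_inj a b : a <> binf -> b <> binf ->
  exponent a =1 exponent b -> a = b.
Proof.
move=> an bn e; rewrite -(monomial_exponent an) -(monomial_exponent bn).
by congr monomial; apply/ffunP => v; rewrite !ffunE.
Qed.

Lemma monomialE k : monomial k = \sum_v sgen K v *+ k v.
Proof.
have monomialMn k' n : monomial (k' *+ n) = monomial k' *+ n.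
  by elim: n => [|n IHn]; rewrite ?mulr0n // !mulrS monomialD IHn.
have {1}-> : k = \sum_v [ffun w => (w == v : nat)] *+ k v.
  apply/ffunP => w; rewrite sum_ffunE (bigD1 w) //= big1 => [|v vw].
    by rewrite addr0 ffunMnE ffunE eqxx /= natn.
  by rewrite ffunMnE ffunE eq_sym (negPf vw) mul0rn.
rewrite (big_morph monomial monomialD (erefl _)).
by apply: eq_bigr => v _; rewrite monomialMn.
Qed.

Lemma specD_neq_binf (p : spec M) (a : M) : specD a p -> a <> binf.
Proof. by move=> ap e; apply: ap; rewrite e; have [[]] := pidealP p. Qed.

Lemma specD_monomial (p : spec M) k :
  specD (monomial k) p <-> forall v, k v != 0%N -> specD (sgen K v) p.
Proof.
rewrite monomialE; split=> [kp v kv|kp].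
  move: kp; rewrite (bigD1 v) //= specDI => -[+ _].
  by rewrite -(prednK (n := k v)) ?lt0n // mulrS specDI => -[].
apply: specD_sum => v; have [->|/kp vp] := eqVneq (k v) 0%N.
  by rewrite mulr0n specD0.
exact: specDX.
Qed.

Lemma exponent_neq0 (p : spec M) a v :
  specD a p -> exponent a v != 0%N -> specD (sgen K v) p.
Proof.
move=> ap av; have := ap; rewrite -(monomial_exponent (specD_neq_binf ap)).
by move/specD_monomial; apply; rewrite ffunE.
Qed.

(** The common point [p] guarantees that [a + b] is not [binf], so its exponents are well
    defined. *)
Lemma exponentD (p : spec M) a b v : specD a p -> specD b p ->
  exponent (a + b) v = (exponent a v + exponent b v)%N.
Proof.
move=> ap bp.
have an := specD_neq_binf ap; have bn := specD_neq_binf bp.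
have abp : specD (a + b) p by rewrite specDI.
rewrite -{1}(monomial_exponent an) -{1}(monomial_exponent bn) -monomialD.
rewrite exponent_monomial ?ffunE // monomialD !monomial_exponent //.
exact: specD_neq_binf abp.
Qed.

Lemma exponentMn (p : spec M) a n v : specD a p ->
  exponent (a *+ n) v = (exponent a v * n)%N.
Proof.
move=> ap; elim: n => [|n IHn].
  (* [0] is [monomial 0] by conversion, and it differs from [binf] because it lies outside [p]. *)
  rewrite mulr0n muln0 [LHS](exponent_monomial (k := 0)) ?ffunE //.
  by apply: (@specD_neq_binf p); rewrite specD0.
by rewrite mulrS (exponentD v ap (specDX ap)) mulnS IHn.
Qed.

(** * Integer weights of unit germs *)

Section Weight.
Variable p : spec M.
Local Notation stalk_p := (bstalk (loc_presheaf M) p).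

(* Independent of the chosen representatives only when the numerator lies
   outside [p], in particular on units. *)
Definition weight (t : stalk_p) (v : V) : int :=
  let g := repr t in let r := repr (gsec g : loc (gidx g)) in
  (exponent r.1 v)%:Z - (exponent (gidx g : M) v * r.2)%:Z.

(** [germ_frac_eq] compares the two representatives; everything involved lies outside [p], so
    exponents add and that of [h] cancels. *)
Lemma weightE (f : M) (fp : specD f p) a m v : specD a p ->
  weight (germ_frac fp a m) v = (exponent a v)%:Z - (exponent f v * m)%:Z.
Proof.
move=> ap; rewrite /weight; set t := germ_frac fp a m.
have : germ (gmem (repr t)) (gsec (repr t)) = t.
  by rewrite -[RHS]reprK; congr (\pi_(stalk _ _) _); case: (repr _).
case: (repr t) => /= g gp; elim/Defs.fracW => b n.
have : Defs.frac g (repr (Defs.frac g b n)).1 (repr (Defs.frac g b n)).2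
    = Defs.frac g b n.
  by rewrite /Defs.frac -surjective_pairing reprK.
case: (repr _) => c k /= <- /germ_frac_eq[h hp e].
have rp : specD (c + f *+ m + h) p.
  by rewrite e !specDI; do !split=> //; apply: specDX.
have cp : specD c p by move: rp; rewrite !specDI => -[[]].
have {rp} := congr1 (fun x => exponent x v) e.
have gX := @specDX _ _ _ k gp; have fX := @specDX _ _ _ m fp.
rewrite !(@exponentD p) ?specDI // !(@exponentMn p) //.
move=> /addIn e'; apply/eqP; rewrite subr_eq addrAC eq_sym subr_eq.
by rewrite -!PoszD eqz_nat e'.
Qed.

Lemma germ_frac_is_unit (f : M) (fp : specD f p) a m :
  germ_frac fp a m \in @is_unit stalk_p -> specD a p.
Proof. by move/is_unitP => [t]; apply: germ_frac_unit. Qed.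

Lemma weightD (s t : stalk_p) v : s \in @is_unit stalk_p ->
  t \in @is_unit stalk_p -> weight (s + t) v = weight s v + weight t v.
Proof.
move: s t; apply: germ_fracW2 => f fp a m b n.
move=> /germ_frac_is_unit ap /germ_frac_is_unit bp.
rewrite germ_fracD !weightE ?specDI // (exponentD v ap bp) mulnDr !PoszD.
by rewrite opprD addrACA.
Qed.

(** Equal weights give [a + f *+ n] and [b + f *+ m] the same exponents; neither is [binf], so they
    are equal. *)
Lemma weight_inj (s t : stalk_p) : s \in @is_unit stalk_p ->
  t \in @is_unit stalk_p -> weight s =1 weight t -> s = t.
Proof.
move: s t; apply: germ_fracW2 => f fp a m b n.
move=> /germ_frac_is_unit ap /germ_frac_is_unit bp e; apply: eq_germ_frac.
have fX := @specDX _ _ _ _ fp.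
apply: exponent_inj => [||v]; try by apply: (@specD_neq_binf p); rewrite specDI.
rewrite !(@exponentD p) // !(exponentMn _ _ fp); have := e v.
rewrite !weightE // => /eqP.
by rewrite subr_eq addrAC eq_sym subr_eq -!PoszD eqz_nat => /eqP.
Qed.

Lemma weight_neq0 (s : stalk_p) v : s \in @is_unit stalk_p ->
  weight s v != 0 -> specD (sgen K v) p.
Proof.
elim/germ_fracW: s => f fp a m /germ_frac_is_unit ap; rewrite weightE //.
have [->|av _] := eqVneq (exponent a v) 0%N; last exact: exponent_neq0 av.
have [->|fv _] := eqVneq (exponent f v) 0%N; last exact: exponent_neq0 fv.
by rewrite mul0n subrr.
Qed.

End Weight.

(** * Smallest neighbourhoods, and sections with prescribed weights *)

Definition generator (p : spec M) : M :=
  monomial [ffun v => `[< specD (sgen K v) p >] : nat].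

Lemma specD_generator (p : spec M) : specD (generator p) p.
Proof. by apply/specD_monomial => v; rewrite ffunE; case: asboolP. Qed.

(** If [specD g] is a neighbourhood of [p], only variables outside [p] occur in [g], and each of
    them is a summand of [generator p]. *)
Lemma specD_generator_sub (p : spec M) (W : set (spec M)) :
  open W -> W p -> specD (generator p) `<=` W.
Proof.
move=> /spec_openE oW /oW[g gp gW]; apply: subset_trans gW => q.
move=> /specD_monomial pq; rewrite -(monomial_exponent (specD_neq_binf gp)).
apply/specD_monomial => v; rewrite ffunE => gv; apply: pq.
by rewrite ffunE asboolT //; apply: exponent_neq0 gv.
Qed.

(* The unit is (sum_v (h v + m) x_v) - m f, with f the sum of the x_v outside p
   and m large enough for the coefficients to be natural numbers. *)
Lemma weight_onto (p : spec M) (h : V -> int) :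
  (forall v, h v != 0 -> specD (sgen K v) p) ->
  exists am : M * nat, forall q (pq : specD (generator p) q),
    germ_frac pq am.1 am.2 \in @is_unit (bstalk (loc_presheaf M) q) /\
    weight (germ_frac pq am.1 am.2) =1 h.
Proof.
move=> hp; pose F v : nat := `[< specD (sgen K v) p >].
pose m := (\sum_v absz (h v))%N.
(* [absz] only moves the exponent into [nat]: [kE] shows its argument nonnegative, for [- h] as well
   as for [h]. *)
pose k (h' : V -> int) := [ffun v => absz (h' v + (F v * m)%N%:Z)].
have kE h' v : `|h' v| = `|h v| -> (k h' v)%:Z = h' v + (F v * m)%N%:Z.
  move=> hh'; rewrite ffunE gez0_abs //.
  have : `|h v| <= (F v * m)%N%:Z.
    have [->|/hp vp] := eqVneq (h v) 0; first by rewrite normr0.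
    by rewrite /F asboolT // mul1n -abszE lez_nat /m (bigD1 v) //= leq_addr.
  by rewrite -hh' ler_norml -subr_ge0 opprK => /andP[].
exists (monomial (k h), m) => q pq /=.
have kq h' : (forall v, `|h' v| = `|h v|) -> specD (monomial (k h')) q.
  move=> hh'; apply/specD_monomial => v; rewrite ffunE => kv.
  have /specD_monomial := pq; apply; rewrite ffunE; case: asboolP => // vp.
  (* For [sgen K v] inside [p], both [h' v] and [F v] vanish, so the variable does not occur. *)
  case/eqP: kv; rewrite /F asboolF // mul0n addr0; apply/eqP.
  by rewrite absz_eq0 -normr_eq0 hh' normr_eq0; apply: contra_notT vp; apply: hp.
have hN v : `|- h v| = `|h v| by apply: normrN.
have fX := @specDX _ _ _ (m + m) pq.
split.
  (* The inverse uses [- h] with the same [m]: the numerators add up to [generator p *+ (m + m)],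
     which cancels both denominators. *)
  apply/is_unitP; exists (germ_frac pq (monomial (k (fun v => - h v))) m).
  rewrite germ_fracD -(germ_frac0 pq); apply: eq_germ_frac.
  rewrite mulr0n addr0 add0r -monomialD; apply: exponent_inj => [||v].
  - by apply: (@specD_neq_binf q); rewrite monomialD specDI; split; apply: kq.
  - exact: specD_neq_binf fX.
  rewrite (exponentMn _ _ pq) exponent_monomial; last first.
    by apply: (@specD_neq_binf q); rewrite monomialD specDI; split; apply: kq.
  rewrite exponent_monomial; last exact: specD_neq_binf pq.
  apply/eqP; rewrite -eqz_nat [X in Posz X]ffunE PoszD !kE // !ffunE.
  by rewrite addrACA subrr add0r -PoszD mulnDr.
move=> v; rewrite weightE; last exact: kq.
rewrite !exponent_monomial; try exact: specD_neq_binf (kq _ _); last first.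
  exact: specD_neq_binf pq.
by rewrite kE // ffunE addrK.
Qed.

(** [specD (generator x)] lies in the neighbourhoods of constancy of all [h v] at once, so one
    fraction from [weight_onto] has the right weights on it. By [weight_inj] the pointwise choices
    agree with that fraction. *)
Lemma sections_of_weights (U : opens (spec M))
    (h : V -> forall x, oset U x -> int) :
  (forall v, locally_constant_on (specD (sgen K v)) (h v)) ->
  exists s : structure_sheaf M U, forall x (Ux : oset U x),
    gval s Ux \in @is_unit (bstalk (loc_presheaf M) x) /\
    weight (gval s Ux) =1 (fun v => h v x Ux).
Proof.
move=> hP.
have loc x (Ux : oset U x) : exists (gU : specD (generator x) `<=` U)
    (am : M * nat), forall q (xq : specD (generator x) q),
    germ_frac xq am.1 am.2 \in @is_unit (bstalk (loc_presheaf M) q) /\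
    weight (germ_frac xq am.1 am.2) =1 (fun v => h v q (gU q xq)).
  exists (specD_generator_sub (oset_open U) Ux).
  have [v|am amP] := @weight_onto x (fun v => h v x Ux).
    have [W [WU [c [Wx hc cW]]]] := hP v x Ux.
    have <- : c = h v x Ux by rewrite -(hc x Wx); congr h; apply: Prop_irrelevance.
    by move/cW; apply.
  exists am => q xq; have [uq wq] := amP q xq; split=> // v; rewrite wq.
  have [W [WU [c [Wx hc _]]]] := hP v x Ux.
  have Wq := specD_generator_sub (oset_open W) Wx xq.
  transitivity c; first by rewrite -(hc x Wx); congr h; apply: Prop_irrelevance.
  by rewrite -(hc q Wq); congr h; apply: Prop_irrelevance.
have tP x (Ux : oset U x) : {t : bstalk (loc_presheaf M) x |
    t \in @is_unit (bstalk (loc_presheaf M) x) /\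
    weight t =1 (fun v => h v x Ux)}.
  apply: cid; have [gU [am amP]] := loc x Ux.
  have [u w] := amP x (@specD_generator x); eexists; split; first exact: u.
  by move=> v; rewrite w; congr h; apply: Prop_irrelevance.
have sP x : oset U x -> exists i (iU : spec_base M i `<=` U)
    (r : nmod_of_binoid (loc_presheaf M) i), spec_base M i x /\
    forall y (iy : spec_base M i y), sval (tP y (iU y iy)) = germ iy r.
  move=> Ux; have [gU [am amP]] := loc x Ux.
  exists (generator x), gU, (Defs.frac _ am.1 am.2); split.
    exact: specD_generator.
  move=> y xy; have [u w] := amP y xy; case: tP => /= t [ut wt].
  by apply: weight_inj => // v; rewrite wt w.
exists (@Sections _ _ (nmod_of_binoid (loc_presheaf M)) U
  (fun x Ux => sval (tP x Ux)) sP) => x Ux /=.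
by case: (tP x Ux).
Qed.

(** * Weights of sections of the unit sheaf *)

Lemma gval_unit (U : opens (spec M))
    (s : units_sheaf (structure_sheaf M) U) x (Ux : oset U x) :
  gval (uval s) Ux \in @is_unit (bstalk (loc_presheaf M) x).
Proof.
apply/is_unitP; exists (gval (uinv s) Ux).
by have := congr1 (fun r : structure_sheaf M U => gval r Ux) (uinvP s).
Qed.

Lemma is_unit0 (N : nmodType) : (0 : N) \in @is_unit N.
Proof. by apply/is_unitP; exists 0; rewrite addr0. Qed.

Lemma weight0 (p : spec M) v : weight (0 : bstalk (loc_presheaf M) p) v = 0.
Proof.
have := weightD v (is_unit0 (bstalk (loc_presheaf M) p)) (is_unit0 _).
by rewrite addr0 -[LHS]addr0 => /addrI.
Qed.

(** An inverse over all of [U] is given by the section of weights [- h], since the sum has weights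
    0. *)
Lemma units_of_weights (U : opens (spec M))
    (h : V -> forall x, oset U x -> int) :
  (forall v, locally_constant_on (specD (sgen K v)) (h v)) ->
  exists s : units_sheaf (structure_sheaf M) U, forall x (Ux : oset U x) v,
    weight (gval (uval s) Ux) v = h v x Ux.
Proof.
move=> hP; have [s sP] := sections_of_weights hP.
have [v x Ux|t tP] := @sections_of_weights U (fun v x Ux => - h v x Ux).
  have [W [WU [c [Wx hc cW]]]] := hP v x Ux.
  exists W, WU, (- c); split=> // [y Wy|]; first by rewrite hc.
  by rewrite oppr_eq0.
have sU : s \in @is_unit (structure_sheaf M U).
  apply/is_unitP; exists t; apply: sections_ext => x Ux.
  have [us ws] := sP x Ux; have [ut wt] := tP x Ux.
  apply: weight_inj; last by move=> v; rewrite weightD // ws wt subrr weight0.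
    have /is_unitP[s' e] := us; have /is_unitP[t' e'] := ut.
    by apply/is_unitP; exists (s' + t'); rewrite addrACA e e' addr0.
  exact: is_unit0.
by exists (Units sU) => x Ux v; have [_ ->] := sP x Ux.
Qed.

(** On a [specD f] where the section is one fraction, its germs are units, so [a] lies outside every
    point and [weightE] yields the same integer throughout. *)
Lemma units_sheaf_locally_constant (U : opens (spec M))
    (s : units_sheaf (structure_sheaf M) U) v :
  locally_constant_on (specD (sgen K v))
    (fun x (Ux : oset U x) => weight (gval (uval s) Ux) v).
Proof.
move=> x Ux; have [f [fU [r [fx hr]]]] := gvalP (uval s) Ux.
move: r hr; elim/Defs.fracW=> a m hr.
have uf q (fq : specD f q) :
    germ_frac fq a m \in @is_unit (bstalk (loc_presheaf M) q).
  by have := gval_unit s (fU q fq); rewrite hr.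
exists (Opens (specD_open f)), fU, (weight (germ_frac fx a m) v).
split=> // [y fy|w0 y fy].
  rewrite hr [LHS]weightE ?weightE //.
  - exact: germ_frac_is_unit (uf _ fx).
  - exact: germ_frac_is_unit (uf _ fy).
apply: (weight_neq0 (uf y fy)); move: w0.
by rewrite !weightE //; [exact: germ_frac_is_unit (uf _ fy)|
  exact: germ_frac_is_unit (uf _ fx)].
Qed.

End SimplicialExponents.

Theorem theorem2p21 (V : finType) (K : simplicial_complex V) :
  zmodSheaf_iso (dsum_sheaf (fun v : V => vertex_sheaf K v))
    (units_sheaf (structure_sheaf (simplicial_binoid K))).
Proof.
pose F := dsum_sheaf (fun v : V => vertex_sheaf K v).
pose G := units_sheaf (structure_sheaf (simplicial_binoid K)).
pose a (U : opens _) (s : F U) x (Ux : oset U x) v : int :=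
  ext_val (gval ((s : dsum (fun v => vertex_sheaf K v U)) v) Ux).
pose b (U : opens _) (s : G U) x (Ux : oset U x) v : int :=
  weight (gval (uval s) Ux) v.
(* The goals are additivity, restriction and injectivity, each for [F] and then [G], followed by the
   two realisations of values. *)
apply: (@zmodSheaf_iso_by_values _ F G V int a b); rewrite /a /b.
- by move=> U s t x Ux v; rewrite ffunE [LHS]ext_valD.
- by move=> U s t x Ux v; rewrite [LHS]weightD //; apply: gval_unit.
- by move=> U W UW s x Ux v; rewrite ffunE.
- by [].
- move=> U s t st; apply/ffunP => v; apply: sections_ext => x Ux.
  by apply: ext_val_inj; apply: st.
- move=> U s t st; apply/val_inj/sections_ext => x Ux.
  by apply: weight_inj; [exact: gval_unit..|exact: st].
- move=> U s; apply: (@units_of_weights _ _ U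
    (fun v x Ux => ext_val (gval ((s : dsum _) v) Ux))) => v.
  exact: ext_sheaf_locally_constant.
- move=> U t.
  have sP v := cid (ext_sheaf_onto (units_sheaf_locally_constant t v)).
  exists ([ffun v => sval (sP v)] : dsum (fun v => vertex_sheaf K v U)).
  by move=> x Ux v; rewrite ffunE; case: (sP v).
Qed.
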